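(* For $n\ge1$ define: $p_1(n)$ is the weighted count of partitions $\pi$ of $n$ whose largest part is even, say $2m$, (the largest part may repeat) and all of whose parts smaller than the largest part are odd, pairwise distinct, and different from $2m-1$; each such $\pi$ is counted with weight $(-1)^{\#_o(\pi)}$, where $\#_o(\pi)$ is the number of odd parts of $\pi$. $p_2(n)$ is the weighted count of partitions $\pi$ of $n$ whose largest part is even, say $2m$, and in which no integer $k$ with $m\le k\le 2m-1$ appears as a part; each such $\pi$ is counted with weight $(-1)^{\#(\pi)-\lambda(\pi)}$, where $\#(\pi)$ is the number of parts of $\pi$ and $\lambda(\pi)$ is the multiplicity of the largest part. $\tau_e(n)$ and $\tau_o(n)$ denote the number of even and odd positive divisors of $n$, respectively. Then for every $n\ge1$, \[ p_1(n)-p_1(n+1)=p_2(n)+\tau_e(n)-\tau_o(n), \] and consequently, for every $N\ge1$, \[ p_1(N)=\sum_{n=1}^{N-1}\left(\tau_o(n)-\tau_e(n)-p_2(n)\right). \] *)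

(* Defs.v *)
From mathcomp Require Import all_boot all_order all_algebra.

Set Implicit Arguments.
Unset Strict Implicit.
Unset Printing Implicit Defensive.

Import GRing.Theory.

Definition is_partition (n : nat) (s : seq nat) : bool :=
  [&& sorted geq s, 0 \notin s & sumn s == n].

(* A partition of n has at most n parts, each at most n; [mem_partitions] and
   [partitions_uniq] below show that the list is exhaustive and has no
   repetitions. *)
Definition partitions (n : nat) : seq (seq nat) :=
  [seq s <- [seq map val (t : seq 'I_n.+1) | t : n.-bseq 'I_n.+1]
  | is_partition n s].

Lemma partitions_uniq n : uniq (partitions n).
Proof.
rewrite filter_uniq // map_inj_uniq ?enum_uniq // => s t /= est.
by apply: val_inj; apply: (inj_map val_inj).
Qed.

Lemma leq_mem_sumn (s : seq nat) k : k \in s -> k <= sumn s.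
Proof.
elim: s => //= x s IHs; rewrite inE => /orP[/eqP -> | /IHs le_k].
  exact: leq_addr.
exact: leq_trans le_k (leq_addl _ _).
Qed.

Lemma size_leq_sumn (s : seq nat) : 0 \notin s -> size s <= sumn s.
Proof.
elim: s => //= x s IHs; rewrite inE negb_or eq_sym -lt0n => /andP[x_gt0 /IHs].
by move=> le_s; rewrite -add1n leq_add.
Qed.

Lemma mem_partitions n s : (s \in partitions n) = is_partition n s.
Proof.
rewrite mem_filter; case: (boolP (is_partition n s)) => //= ps.
case/and3P: (ps) => _ s0 /eqP sum_s.
have sz_s : size (map (@inord n) s) <= n.
  by rewrite size_map (leq_trans (size_leq_sumn s0)) ?sum_s.
apply/mapP; exists (Bseq sz_s); first by rewrite mem_enum.
rewrite /= -map_comp -[LHS]map_id; apply/eq_in_map => k ks /=.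
by rewrite inordK // ltnS -sum_s leq_mem_sumn.
Qed.

Definition largest (s : seq nat) : nat := \max_(k <- s) k.

Definition largest_mult (s : seq nat) : nat := count_mem (largest s) s.

Definition p1_admissible (s : seq nat) : bool :=
  let smaller := [seq k <- s | k < largest s] in
  [&& ~~ odd (largest s), uniq smaller
    & all (fun k => odd k && (k != largest s - 1)) smaller].

Definition p2_admissible (s : seq nat) : bool :=
  let m := (largest s)./2 in
  ~~ odd (largest s) && all (fun k => ~~ (m <= k <= 2 * m - 1)) s.

Definition p1 (n : nat) : int :=
  (\sum_(s <- partitions n | p1_admissible s) (-1) ^+ count odd s)%R.

Definition p2 (n : nat) : int :=
  (\sum_(s <- partitions n | p2_admissible s)
     (-1) ^+ (size s - largest_mult s)%N)%R.

Definition tau_e (n : nat) : nat := count (fun d => ~~ odd d) (divisors n).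

Definition tau_o (n : nat) : nat := count odd (divisors n).

(* Main.v *)
Require Import Defs.
From mathcomp Require Import all_boot all_order all_algebra.
From mathcomp Require Import ring zify.

(** Write (a)_m for (a; q)_m. The generating functions are
    P1 = sum_m q^(2m)/(1-q^(2m)) (q; q^2)_(m-1),
    P2 = sum_m q^(2m)/(1-q^(2m)) / (-q)_(m-1),
    C = sum_k q^k/(1+q^k) for tau_o - tau_e,
    and the claim is (1-q) P1 + q P2 = q C.
    With E = (q; q^2)_oo = 1/(-q)_oo, telescoping gives
    (1-q) P1 = q (1-E) - q B and P2 = A - (1-E), where
    A = sum_m q^m/(1-q^m) / (-q)_m and B = sum_m q^(2m)/(1-q^(2m)) (q; q^2)_m,
    so one needs A - B = C.
    Put S_r = sum_(s <= r) 1/(1-q^(2s)). Replacing (-q)_m by (-q^(i+1))_m in A and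
    telescoping over i yields A = sum_k q^k/(1-q^k) + C - E sum_i ((-q)_oo - (-q)_i);
    by (-q)_i = sum_r q^r [i, r]_(q^2) (the Rogers-Szego form of Fine's refinement
    of Euler's theorem), the last sum is sum_r q^r S_r / (q^2; q^2)_r. Expanding
    (q; q^2)_m / E by Euler's theorem, B / E is the sum over r of
    q^r / (q^2; q^2)_r (sum_k q^(2k)/(1-q^(2k)) - S_r + r), and
    sum_r r q^r / (q^2; q^2)_r is a logarithmic derivative. The S_r cancel.

    Power series are replaced by elements of a commutative ring in which q is
    nilpotent; coefficients are read off in Z[X]/(X^(n+2)). *)

Set Implicit Arguments.
Unset Strict Implicit.
Unset Printing Implicit Defensive.
Import GRing.Theory.
Local Open Scope ring_scope.

(** * q-series at a nilpotent q *)

Section NilpotentQSeries.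

Variables (R : comNzRingType) (N : nat) (q : R).
Hypothesis qN0 : q ^+ N = 0.

Lemma nilp_expr0 k : (N <= k)%N -> q ^+ k = 0.
Proof. by move=> leNk; rewrite -(subnK leNk) exprD qN0 mulr0. Qed.

Lemma nilp_order_gt0 : (0 < N)%N.
Proof.
by rewrite lt0n; apply/eqP => N0; move: qN0 => /eqP; rewrite N0 expr0 oner_eq0.
Qed.

(** The geometric series cut at N terms, which still inverts 1 - x once x^N = 0. *)
Definition geom (x : R) : R := \sum_(i < N) x ^+ i.

Lemma geomP x : x ^+ N = 0 -> (1 - x) * geom x = 1.
Proof.
move=> x0; have := subrX1 x N; rewrite x0 /geom => H.
by rewrite -opprB mulNr -H sub0r opprK.
Qed.

(* 1 / (1 - q^k) and 1 / (1 + q^k), for 0 < k. *)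
Definition inv_subX k := geom (q ^+ k).
Definition inv_addX k := geom (- q ^+ k).

Lemma inv_subXP k : (0 < k)%N -> (1 - q ^+ k) * inv_subX k = 1.
Proof. by move=> k0; apply: geomP; rewrite -exprM nilp_expr0 // leq_pmull. Qed.

Lemma inv_addXP k : (0 < k)%N -> (1 + q ^+ k) * inv_addX k = 1.
Proof.
move=> k0; rewrite -[X in 1 + X]opprK; apply: geomP.
by rewrite exprNn -exprM nilp_expr0 ?mulr0 // leq_pmull.
Qed.

Lemma mulX_inv_addX k : (0 < k)%N -> q ^+ k * inv_addX k = 1 - inv_addX k.
Proof. by move=> /inv_addXP <-; ring. Qed.

Lemma inv_addX_large k : (0 < k)%N -> (N <= k)%N -> inv_addX k = 1.
Proof. by move=> /inv_addXP + /nilp_expr0 => <- ->; ring. Qed.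

Lemma inv_subX_double k : (0 < k)%N -> inv_subX (2 * k) = inv_subX k * inv_addX k.
Proof.
move=> k0; have k20 : (0 < 2 * k)%N by rewrite muln_gt0.
have := inv_subXP k20; have := inv_subXP k0; have := inv_addXP k0.
rewrite (mulnC 2 k) exprM; set y := q ^+ k => hj hi hk.
have -> : inv_subX (k * 2) =
    ((1 - y) * inv_subX k) * ((1 + y) * inv_addX k) * inv_subX (k * 2).
  by rewrite hj hi !mul1r.
transitivity (inv_subX k * inv_addX k * ((1 - y ^+ 2) * inv_subX (k * 2))); first by ring.
by rewrite hk mulr1.
Qed.

(** Moves the index of a cut sum by one without boundary terms, so that both sides of a q-difference
    equation can be compared termwise. *)
Lemma sum_shift (a : nat -> R) : a 0%N = 0 -> a N = 0 ->
  \sum_(r < N) a r = \sum_(r < N) a r.+1.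
Proof.
move=> a0 aN; transitivity (\sum_(r < N.+1) a r).
  by rewrite big_ord_recr /= aN addr0.
by rewrite big_ord_recl /= a0 add0r.
Qed.

Lemma sum_trunc M (a : nat -> R) : (N <= M)%N ->
  (forall i, (N <= i)%N -> a i = 0) -> \sum_(i < M) a i = \sum_(i < N) a i.
Proof.
move=> /subnKC <- a0; rewrite big_split_ord /= [X in _ + X]big1 ?addr0 // => i _.
by rewrite a0 // leq_addr.
Qed.

Lemma telescope_ord n (a : nat -> R) : \sum_(i < n) (a i - a i.+1) = a 0%N - a n.
Proof.
elim: n => [|n IH]; first by rewrite big_ord0 subrr.
by rewrite big_ord_recr /= IH; ring.
Qed.

(* In Pochhammer notation, the next definitions are (q; q^2)_m, (-q; q)_m,
   1 / (-q^(i+1); q)_m, 1 / (q^2; q^2)_r and (q^(2(i-r+1)); q^2)_r. The last one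
   is 0 for i < r, since the truncated difference i - s reaches 0. *)
Definition odd_poch m := \prod_(s < m) (1 - q ^+ (2 * s).+1).
Definition neg_poch m := \prod_(s < m) (1 + q ^+ s.+1).
Definition inv_neg_poch i m := \prod_(s < m) inv_addX (s + i).+1.
Definition inv_qfact r := \prod_(s < r) inv_subX (2 * s.+1).
Definition qfall i r := \prod_(s < r) (1 - q ^+ (2 * (i - s))).

Lemma odd_pochS m : odd_poch m.+1 = odd_poch m * (1 - q ^+ (2 * m).+1).
Proof. by rewrite /odd_poch big_ord_recr. Qed.
Lemma neg_pochS m : neg_poch m.+1 = neg_poch m * (1 + q ^+ m.+1).
Proof. by rewrite /neg_poch big_ord_recr. Qed.
Lemma inv_neg_pochSr i m : inv_neg_poch i m.+1 = inv_neg_poch i m * inv_addX (m + i).+1.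
Proof. by rewrite /inv_neg_poch big_ord_recr. Qed.
Lemma inv_neg_pochSl i m : inv_neg_poch i m.+1 = inv_addX i.+1 * inv_neg_poch i.+1 m.
Proof.
rewrite /inv_neg_poch big_ord_recl /= add0n; congr (_ * _); apply: eq_bigr => s _.
by rewrite /bump /= add1n addnS.
Qed.
Lemma inv_qfactS r : inv_qfact r.+1 = inv_qfact r * inv_subX (2 * r.+1).
Proof. by rewrite /inv_qfact big_ord_recr. Qed.
Lemma inv_qfactK r : (1 - q ^+ (2 * r.+1)) * inv_qfact r.+1 = inv_qfact r.
Proof. by rewrite inv_qfactS mulrCA inv_subXP ?mulr1. Qed.
Lemma qfallSr i r : qfall i r.+1 = qfall i r * (1 - q ^+ (2 * (i - r))).
Proof. by rewrite /qfall big_ord_recr. Qed.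
Lemma qfallSl i r : qfall i.+1 r.+1 = (1 - q ^+ (2 * i.+1)) * qfall i r.
Proof. by rewrite /qfall big_ord_recl /= subn0. Qed.
Lemma qfall_small i r : (i < r)%N -> qfall i r = 0.
Proof.
move=> lt_ir; rewrite /qfall (bigD1 (Ordinal lt_ir)) //=.
by rewrite subnn muln0 expr0 subrr mul0r.
Qed.
Lemma qfall_large i r : (N + r <= i.+1)%N -> qfall i r = 1.
Proof.
move=> le_i; apply: big1 => s _; rewrite nilp_expr0 ?subr0 //.
have := ltn_ord s; lia.
Qed.
Lemma neg_poch_large m : (N <= m)%N -> neg_poch m = neg_poch N.
Proof.
move=> /subnKC <-; elim: (m - N)%N => [|k IH]; first by rewrite addn0.
by rewrite addnS neg_pochS IH nilp_expr0 ?addr0 ?mulr1 // -addnS leq_addr.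
Qed.

Lemma neg_pochK i m : neg_poch (m + i) * inv_neg_poch i m = neg_poch i.
Proof.
elim: m => [|m IH]; first by rewrite /inv_neg_poch big_ord0 mulr1.
by rewrite addSn neg_pochS inv_neg_pochSr mulrACA inv_addXP // mulr1.
Qed.

(* 1 / (z; q^2)_oo expanded by Euler's theorem, and its image under z d/dz, at
   z = q^(2m+1). *)
Definition euler_sum m := \sum_(r < N) q ^+ ((2 * m).+1 * r) * inv_qfact r.
Definition euler_dsum m := \sum_(r < N) q ^+ ((2 * m).+1 * r) * inv_qfact r *+ r.

(** Termwise in z = q^(2m+1): the factor 1 - q^(2r) that comes from replacing z by q^2 z cancels the
    last factor of 1 / (q^2; q^2)_r. *)
Lemma euler_sum_rec m : (1 - q ^+ (2 * m).+1) * euler_sum m = euler_sum m.+1.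
Proof.
have H : euler_sum m - euler_sum m.+1 = q ^+ (2 * m).+1 * euler_sum m;
    last by rewrite mulrBl -H mul1r; ring.
rewrite /euler_sum -sumrB.
rewrite (@sum_shift (fun r => q ^+ ((2 * m).+1 * r) * inv_qfact r
                            - q ^+ ((2 * m.+1).+1 * r) * inv_qfact r)); first last.
- by rewrite !nilp_expr0 ?mul0r ?subrr // leq_pmull.
- by rewrite !muln0 subrr.
rewrite mulr_sumr; apply: eq_bigr => r _.
rewrite -[in RHS]inv_qfactK !mulrA -exprD.
have -> : ((2 * m).+1 * r.+1 = (2 * m).+1 + (2 * m).+1 * r)%N by lia.
have -> : ((2 * m.+1).+1 * r.+1 = ((2 * m).+1 + (2 * m).+1 * r) + 2 * r.+1)%N by lia.
by rewrite !exprD; ring.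
Qed.

(** The operator z d/dz applied to (1 - z) F(z) = F(q^2 z), with F(z) = 1 / (z; q^2)_oo. *)
Lemma euler_dsum_rec m : (1 - q ^+ (2 * m).+1) * euler_dsum m =
    euler_dsum m.+1 + q ^+ (2 * m).+1 * euler_sum m.
Proof.
have H : euler_dsum m - euler_dsum m.+1 = q ^+ (2 * m).+1 * (euler_dsum m + euler_sum m).
  rewrite /euler_sum /euler_dsum -sumrB.
  rewrite (@sum_shift (fun r => q ^+ ((2 * m).+1 * r) * inv_qfact r *+ r
                              - q ^+ ((2 * m.+1).+1 * r) * inv_qfact r *+ r)); first last.
  - by rewrite !nilp_expr0 ?mul0r ?mul0rn ?subrr // leq_pmull.
  - by rewrite !muln0 subrr.
  rewrite -big_split mulr_sumr; apply: eq_bigr => r _ /=.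
  rewrite -mulrSr -[X in _ = _ * (_ * X *+ _)]inv_qfactK mulrnAr !mulrA -exprD.
  have -> : ((2 * m).+1 * r.+1 = (2 * m).+1 + (2 * m).+1 * r)%N by lia.
  have -> : ((2 * m.+1).+1 * r.+1 = ((2 * m).+1 + (2 * m).+1 * r) + 2 * r.+1)%N by lia.
  by rewrite !exprD; ring.
by rewrite mulrBl mul1r -[X in X - _](subrK (euler_dsum m.+1)) H; ring.
Qed.

Lemma odd_poch_euler_sum m : odd_poch m * euler_sum 0 = euler_sum m.
Proof.
elim: m => [|m IH]; first by rewrite /odd_poch big_ord0 mul1r.
by rewrite odd_pochS mulrAC IH mulrC euler_sum_rec.
Qed.

(* Logarithmic derivative of 1 / (z; q^2)_oo. *)
Lemma odd_poch_euler_dsum m :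
  odd_poch m * euler_dsum 0 =
      euler_dsum m + euler_sum m * \sum_(s < m) q ^+ (2 * s).+1 * inv_subX (2 * s).+1.
Proof.
elim: m => [|m IH]; first by rewrite /odd_poch !big_ord0 mul1r mulr0 addr0.
rewrite odd_pochS mulrAC IH mulrC mulrDr euler_dsum_rec big_ord_recr /= mulrA
    euler_sum_rec.
rewrite [_ * (_ + _)]mulrDr -!addrA; congr (_ + _).
rewrite -(euler_sum_rec m) addrC; congr (_ + _).
by rewrite -[LHS]mulr1 -[X in _ * X = _](inv_subXP (ltn0Sn (2 * m))); ring.
Qed.

Lemma euler_sum_large : euler_sum N = 1.
Proof.
rewrite /euler_sum (bigD1 (Ordinal nilp_order_gt0)) //= big1 => [|r r0].
  by rewrite muln0 /inv_qfact big_ord0 mulr1 addr0.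
rewrite nilp_expr0 ?mul0r //; have : (0 < r)%N by rewrite lt0n.
by nia.
Qed.

Lemma euler_dsum_large : euler_dsum N = 0.
Proof.
rewrite /euler_dsum big1 // => -[[|i] ltiN] _ //=.
by rewrite nilp_expr0 ?mul0r ?mul0rn //; lia.
Qed.

Lemma odd_poch_euler_dsumN : odd_poch N * euler_dsum 0 =
    \sum_(s < N) q ^+ (2 * s).+1 * inv_subX (2 * s).+1.
Proof. by rewrite odd_poch_euler_dsum euler_sum_large euler_dsum_large add0r mul1r. Qed.

Lemma odd_poch_euler_sumN : odd_poch N * euler_sum 0 = 1.
Proof. by rewrite odd_poch_euler_sum euler_sum_large. Qed.

(** * Rogers-Szego polynomials and Euler's theorem on odd and distinct parts *)

(** Divided by (q^2; q^2)_(r+1), this is a Pascal rule for [i, r]_(q^2); summed over r, it yields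
    the three-term recurrence. *)
Lemma qfall_rec i r : qfall i.+2 r.+1 =
  qfall i.+1 r.+1 + (1 - q ^+ (2 * r.+1)) * (qfall i.+1 r - (1 - q ^+ (2 * i.+1)) *
      qfall i r).
Proof.
rewrite -qfallSl [LHS]qfallSl qfallSr; have [lt_ir|le_ri] := ltnP i.+1 r.
  by rewrite qfall_small // mul0r !mulr0 subrr mulr0 addr0.
have -> : (2 * i.+2 = 2 * (i.+1 - r) + 2 * r.+1)%N by lia.
by rewrite !exprD; ring.
Qed.

(* The Rogers-Szego polynomial in base q^2 at the point q; its three-term
   recurrence is also satisfied by (-q; q)_i. *)
Definition rogers_szego i := \sum_(r < N) q ^+ r * (qfall i r * inv_qfact r).

Lemma rogers_szego_rec i : rogers_szego i.+2 =
    (1 + q) * rogers_szego i.+1 - q * (1 - q ^+ (2 * i.+1)) * rogers_szego i.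
Proof.
have H : rogers_szego i.+2 - rogers_szego i.+1 =
    q * rogers_szego i.+1 - q * (1 - q ^+ (2 * i.+1)) * rogers_szego i; last first.
  by rewrite -[LHS](subrK (rogers_szego i.+1)) H; ring.
rewrite /rogers_szego !mulr_sumr -!sumrB.
rewrite (@sum_shift (fun r => q ^+ r * (qfall i.+2 r * inv_qfact r)
                            - q ^+ r * (qfall i.+1 r * inv_qfact r))); first last.
- by rewrite !nilp_expr0 // !mul0r subrr.
- by rewrite /qfall !big_ord0 subrr.
apply: eq_bigr => r _; rewrite qfall_rec -[in RHS]inv_qfactK exprS; ring.
Qed.

Lemma rogers_szegoE i : rogers_szego i = neg_poch i.
Proof.
suff: rogers_szego i = neg_poch i /\ rogers_szego i.+1 = neg_poch i.+1 by case.
have h0 : rogers_szego 0 = 1.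
  rewrite /rogers_szego -(prednK nilp_order_gt0) big_ord_recl /= big1.
    by rewrite /qfall /inv_qfact !big_ord0 !mul1r addr0.
  by move=> r _; rewrite qfall_small // !(mul0r, mulr0).
have h1 : rogers_szego 1 = 1 + q.
  have -> : rogers_szego 1 = rogers_szego 0 + q * rogers_szego 0;
      last by rewrite h0 mulr1.
  apply/eqP; rewrite addrC -subr_eq; apply/eqP; rewrite /rogers_szego mulr_sumr -sumrB.
  rewrite (@sum_shift (fun r => q ^+ r * (qfall 1 r * inv_qfact r)
                              - q ^+ r * (qfall 0 r * inv_qfact r))); first last.
  - by rewrite !nilp_expr0 // !mul0r subrr.
  - by rewrite /qfall !big_ord0 subrr.
  apply: eq_bigr => r _; rewrite qfallSl (qfall_small (ltn0Sn r)).
  case: (val r) => [|k]; first rewrite -[in RHS]inv_qfactK.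
    by rewrite !expr1 /qfall !big_ord0; ring.
  by rewrite (qfall_small (ltn0Sn k)); ring.
elim: i => [|i [IH0 IH1]].
  by rewrite h0 h1 /neg_poch big_ord0 big_ord1.
split=> //; rewrite rogers_szego_rec IH1 IH0 !neg_pochS.
have -> : (2 * i.+1 = i.+1 + i.+1)%N by lia.
by rewrite exprD [q ^+ i.+2]exprS; move: (q ^+ i.+1) (neg_poch i) => x y; ring.
Qed.

(** The limit of the Rogers-Szego identity: at i = 2N every [qfall i r] with r < N is already 1, and
    [neg_poch] is constant from N on. *)
Lemma euler_sum_neg_poch m : (N <= m)%N -> euler_sum 0 = neg_poch m.
Proof.
move=> /neg_poch_large ->;
    rewrite -(@neg_poch_large (N + N)) ?leq_addr // -rogers_szegoE; apply: eq_bigr => r _.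
by rewrite qfall_large ?mul1r ?mul1n //; have := ltn_ord r; lia.
Qed.

(** By induction on r: [qfall i r - qfall i r.+1] equals [qfall i.+1 r.+1 - qfall i r.+1] divided by
    1 - q^(2(r+1)), and this telescopes over i. *)
Lemma sum_qfall r : (r <= N)%N ->
  \sum_(i < N + N) (1 - qfall i r) = \sum_(s < r) inv_subX (2 * s.+1).
Proof.
elim: r => [_|r IH ltrN].
  by rewrite big_ord0 big1 // => i _; rewrite /qfall big_ord0 subrr.
rewrite big_ord_recr /= -IH 1?ltnW // addrC -[RHS]mulr1; apply/eqP.
rewrite mulr1 -subr_eq -sumrB; apply/eqP.
transitivity (inv_subX (2 * r.+1) * \sum_(i < N + N) (qfall i.+1 r.+1 - qfall i r.+1)).
  rewrite mulr_sumr; apply: eq_bigr => i _.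
  rewrite qfallSl qfallSr; have [lt_ir|le_ri] := ltnP i r.
    by rewrite qfall_small //; ring.
  have {1}-> : (2 * i.+1 = 2 * (i - r) + 2 * r.+1)%N by lia.
  rewrite exprD.
  transitivity (((1 - q ^+ (2 * r.+1)) * inv_subX (2 * r.+1)) * qfall i r * q ^+ (2 *
      (i - r))).
    by rewrite inv_subXP //; ring.
  by ring.
rewrite -[X in _ * X]opprK -sumrN.
under eq_bigr => i _ do rewrite opprB.
rewrite (telescope_ord _ (fun i => qfall i r.+1)) (qfall_small (ltn0Sn r)).
by rewrite qfall_large ?sub0r ?opprK ?mulr1 //; lia.
Qed.

(** * The series A, telescoped over the starting index of its products *)

Definition neg_lambert i := \sum_(m < N) q ^+ m.+1 * inv_subX m.+1 * inv_neg_poch i m.+1.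

(** With x = q^(m+1) and y = q^(i+1), the difference 1/(1+y) - 1/(1+xy) contains the factor 1 - x,
    which cancels 1/(1-x); what is left telescopes over m. *)
Lemma neg_lambert_rec i : neg_lambert i - neg_lambert i.+1 =
    inv_neg_poch i N.+1 - inv_addX i.+1.
Proof.
rewrite /neg_lambert -sumrB.
transitivity (- \sum_(m < N) (inv_neg_poch i m.+1 - inv_neg_poch i m.+2)).
  rewrite -sumrN; apply: eq_bigr => m _.
  have -> : inv_neg_poch i m.+1 - inv_neg_poch i m.+2 =
      inv_neg_poch i m.+1 * (q ^+ (m + i).+2 * inv_addX (m + i).+2).
    by rewrite mulX_inv_addX // [inv_neg_poch i m.+2]inv_neg_pochSr; ring.
  rewrite inv_neg_pochSl [inv_neg_poch i.+1 m.+1]inv_neg_pochSr addnS.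
  set w := inv_neg_poch _ _; set v := inv_subX _; set a := inv_addX i.+1;
      set b := inv_addX _.
  have ha := inv_addXP (ltn0Sn i); have hb := inv_addXP (ltn0Sn (m + i).+1).
  have hv := inv_subXP (ltn0Sn m); rewrite -/a in ha; rewrite -/b in hb;
      rewrite -/v in hv.
  have E : q ^+ (m + i).+2 = q ^+ m.+1 * q ^+ i.+1 by rewrite -exprD; congr (_ ^+ _); lia.
  rewrite E in hb *; move: hv ha hb; set x := q ^+ m.+1; set y := q ^+ i.+1 => hv ha hb.
  transitivity (x * v * w * (a * ((1 + x * y) * b) - b * ((1 + y) * a))).
    by rewrite ha hb; ring.
  transitivity (- (((1 - x) * v) * (a * w * (x * y * b)))); first by ring.
  by rewrite hv; ring.
rewrite (telescope_ord _ (fun m => inv_neg_poch i m.+1)) /= opprB; congr (_ - _).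
by rewrite inv_neg_pochSr /inv_neg_poch big_ord0 mul1r.
Qed.

Definition alt_lambert := \sum_(k < N) q ^+ k.+1 * inv_addX k.+1.
Definition lambert := \sum_(k < N) q ^+ k.+1 * inv_subX k.+1.

Lemma neg_lambert_large : neg_lambert (N + N) = lambert.
Proof.
apply: eq_bigr => m _; rewrite -[RHS]mulr1; congr (_ * _); apply: big1 => s _.
by rewrite inv_addX_large //; lia.
Qed.

(** Summing [neg_lambert_rec] over i < 2N gives the terms [1 - inv_addX i.+1], which add up to
    [alt_lambert], minus the terms [1 - inv_neg_poch i N.+1], which become (-q)_oo - (-q)_i after
    multiplication by 1/E. *)
Lemma euler_sum_neg_lambert : euler_sum 0 * neg_lambert 0 =
    euler_sum 0 * (lambert + alt_lambert) -
  \sum_(r < N) q ^+ r * inv_qfact r * \sum_(s < r) inv_subX (2 * s.+1).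
Proof.
have H : neg_lambert 0 - neg_lambert (N + N) =
    \sum_(i < N + N) (inv_neg_poch i N.+1 - inv_addX i.+1).
  by rewrite -telescope_ord; apply: eq_bigr => i _; rewrite neg_lambert_rec.
rewrite -[neg_lambert 0](subrK (neg_lambert (N + N))) H neg_lambert_large.
have -> : alt_lambert = \sum_(i < N + N) (1 - inv_addX i.+1).
  rewrite /alt_lambert -(@sum_trunc (N + N) (fun i => q ^+ i.+1 *
      inv_addX i.+1)) ?leq_addr //.
    by apply: eq_bigr => i _; rewrite mulX_inv_addX.
  by move=> i leNi; rewrite nilp_expr0 ?mul0r //; lia.
have -> : \sum_(r < N) q ^+ r * inv_qfact r * \sum_(s < r) inv_subX (2 * s.+1) =
          \sum_(i < N + N) (euler_sum 0 - euler_sum 0 * inv_neg_poch i N.+1).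
  (* (-q)_oo - (-q)_i is the sum over r of q^r (1 - [qfall i r]) / (q^2; q^2)_r, so summing over i
     first brings in [sum_qfall]. *)
  transitivity (\sum_(r < N) \sum_(i < N + N) q ^+ r * inv_qfact r * (1 - qfall i r)).
    by apply: eq_bigr => r _; rewrite -mulr_sumr sum_qfall // ltnW.
  rewrite exchange_big; apply: eq_bigr => i _ /=.
  rewrite [X in X * inv_neg_poch _ _](@euler_sum_neg_poch (N.+1 + i)) ?neg_pochK;
      last by lia.
  rewrite -rogers_szegoE /euler_sum /rogers_szego -sumrB; apply: eq_bigr => r _.
  by rewrite mul1n; ring.
rewrite mulrDr.
have -> : euler_sum 0 * \sum_(i < N + N) (inv_neg_poch i N.+1 - inv_addX i.+1) =
    euler_sum 0 * \sum_(i < N + N) (1 - inv_addX i.+1) - \sum_(i < N +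
        N) (euler_sum 0 - euler_sum 0 * inv_neg_poch i N.+1).
  by rewrite !mulr_sumr -sumrB; apply: eq_bigr => i _; ring.
ring.
Qed.

(** * The series B and the identity A - B = C *)

Definition odd_lambert := \sum_(m < N) q ^+ (2 * m.+1) * inv_subX (2 * m.+1) *
    odd_poch m.+1.
Definition even_lambert := \sum_(m < N) q ^+ (2 * m.+1) * inv_subX (2 * m.+1).

(** Raising r by one subtracts the geometric sum of q^(2m(r+1)) over m >= 1, which is 1 / (1 -
    q^(2(r+1))) - 1. *)
Lemma even_lambert_tail r : \sum_(m < N) q ^+ (2 * m.+1 * r.+1) * inv_subX (2 * m.+1) =
  even_lambert - \sum_(s < r) inv_subX (2 * s.+1) + r%:R.
Proof.
elim: r => [|r IH].
  rewrite big_ord0 subr0 addr0; apply: eq_bigr => m _; by rewrite muln1.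
set tail := fun r : nat => \sum_(m < N) q ^+ (2 * m.+1 * r.+1) * inv_subX (2 * m.+1).
suff H : tail r.+1 - tail r = 1 - inv_subX (2 * r.+1).
  rewrite -[LHS](subrK (tail r)) H [tail r]IH big_ord_recr /= -natr1; ring.
rewrite -sumrB.
transitivity (- \sum_(m < N) (q ^+ (2 * r.+1)) ^+ m.+1).
  rewrite -sumrN; apply: eq_bigr => m _; rewrite -exprM.
  have -> : (2 * m.+1 * r.+2 = 2 * m.+1 + 2 * m.+1 * r.+1)%N by lia.
  rewrite exprD -[X in _ = - X]mulr1 -(inv_subXP (k := 2 * m.+1)) //.
  have -> : (2 * r.+1 * m.+1 = 2 * m.+1 * r.+1)%N by lia.
  by ring.
rewrite -opprB; congr (- _).
have h : (q ^+ (2 * r.+1)) ^+ N = 0 by rewrite -exprM nilp_expr0 //; lia.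
rewrite /inv_subX /geom; apply/eqP; rewrite eq_sym subr_eq; apply/eqP.
transitivity (\sum_(i < N.+1) (q ^+ (2 * r.+1)) ^+ i).
  by rewrite big_ord_recr /= h addr0.
by rewrite big_ord_recl /= expr0 addrC.
Qed.

(** Since (q; q^2)_m / E is [euler_sum m], exchanging the two sums leaves the sum of
    [even_lambert_tail] for each r; its summand r produces [euler_dsum 0]. *)
Lemma euler_sum_odd_lambert : euler_sum 0 * odd_lambert = euler_sum 0 * even_lambert -
  (\sum_(r < N) q ^+ r * inv_qfact r * \sum_(s < r) inv_subX (2 * s.+1)) + euler_dsum 0.
Proof.
transitivity (\sum_(m < N) \sum_(r < N)
    (q ^+ r * inv_qfact r) * (q ^+ (2 * m.+1 * r.+1) * inv_subX (2 * m.+1))).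
  rewrite mulr_sumr; apply: eq_bigr => m _.
  rewrite mulrCA [euler_sum 0 * _]mulrC odd_poch_euler_sum mulr_sumr;
      apply: eq_bigr => r _.
  have -> : ((2 * m.+1).+1 * r = r + 2 * m.+1 * r)%N by lia.
  have -> : (2 * m.+1 * r.+1 = 2 * m.+1 + 2 * m.+1 * r)%N by lia.
  by rewrite !exprD; ring.
rewrite exchange_big /= {1}/euler_sum /euler_dsum mulr_suml -sumrB -big_split /=.
apply: eq_bigr => r _.
rewrite -mulr_sumr even_lambert_tail mul1n -[_ *+ r]mulr_natr; ring.
Qed.

Lemma lambert_split :
  lambert = even_lambert + \sum_(s < N) q ^+ (2 * s).+1 * inv_subX (2 * s).+1.
Proof.
rewrite /lambert -(@sum_trunc (2 * N) (fun i => q ^+ i.+1 * inv_subX i.+1)); first last.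
- by move=> i leNi; rewrite nilp_expr0 ?mul0r //; lia.
- by lia.
rewrite /even_lambert -big_split /=; elim: N => [|n IH]; first by rewrite muln0 !big_ord0.
rewrite mulnS !addSn add0n !big_ord_recr /= IH mulnS !addSn add0n -addrA; congr (_ + _).
by rewrite addrC.
Qed.

(** After division by E the sums of S_r cancel; the odd-exponent half of [lambert] that remains
    beside [alt_lambert] equals E times [euler_dsum 0]. *)
Lemma neg_lambert_odd_lambert : neg_lambert 0 - odd_lambert = alt_lambert.
Proof.
rewrite -[LHS]mul1r -odd_poch_euler_sumN -mulrA mulrBr euler_sum_neg_lambert
    euler_sum_odd_lambert lambert_split.
transitivity (odd_poch N * euler_sum 0 * (alt_lambert + \sum_(s < N) q ^+ (2 * s).+1 *
    inv_subX (2 * s).+1)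
   - odd_poch N * euler_dsum 0); first by ring.
by rewrite odd_poch_euler_sumN odd_poch_euler_dsumN; ring.
Qed.

(** * Telescoping the series P1 and P2 *)

Definition p1_series := \sum_(m < N) q ^+ (2 * m.+1) * inv_subX (2 * m.+1) * odd_poch m.
Definition p2_series := \sum_(m < N) q ^+ (2 * m.+1) * inv_subX (2 * m.+1) *
    inv_neg_poch 0 m.

(** Termwise, (1 - q) + q (1 - q^(2m+1)) = 1 - q^(2m+2) cancels the denominator, and the rest is q
    times a difference of consecutive (q; q^2)_m. *)
Lemma p1_series_odd_lambert : (1 - q) * p1_series + q * odd_lambert =
    q * (1 - odd_poch N).
Proof.
have -> : 1 - odd_poch N = odd_poch 0 - odd_poch N by rewrite [odd_poch 0]big_ord0.
rewrite -telescope_ord !mulr_sumr -big_split; apply: eq_bigr => m _ /=.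
rewrite odd_pochS; have := inv_subXP (k := 2 * m.+1) isT.
have -> : q ^+ (2 * m.+1) = q * q ^+ (2 * m).+1 by rewrite -exprS; congr (_ ^+ _); lia.
set x := q ^+ _; set v := inv_subX _ => hv.
transitivity (((1 - q * x) * v) * (q * x * odd_poch m)); first by ring.
by rewrite hv; ring.
Qed.

(** Termwise, x^2/(1-x^2) + x/(1+x) = x/((1-x)(1+x)) at x = q^(m+1), and the summands x/(1+x) /
    (-q)_m telescope. *)
Lemma p2_series_neg_lambert : p2_series + (1 - inv_neg_poch 0 N) = neg_lambert 0.
Proof.
have -> : 1 - inv_neg_poch 0 N =
    inv_neg_poch 0 0 - inv_neg_poch 0 N by rewrite [inv_neg_poch 0 0]big_ord0.
rewrite -telescope_ord -big_split; apply: eq_bigr => m _ /=.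
rewrite inv_neg_pochSr addn0 inv_subX_double // mulnC exprM.
have := inv_subXP (ltn0Sn m); have := inv_addXP (ltn0Sn m).
set x := q ^+ _; set v := inv_subX _; set b := inv_addX _ => hb hv.
transitivity (x ^+ 2 * (v * b) * inv_neg_poch 0 m + inv_neg_poch 0 m * ((1 + x) * b) -
    inv_neg_poch 0 m * b).
  by rewrite hb; ring.
transitivity (x ^+ 2 * (v * b) * inv_neg_poch 0 m + inv_neg_poch 0 m * x * b * ((1 -
    x) * v)).
  by rewrite hv; ring.
by ring.
Qed.

Lemma odd_poch_inv_neg_poch : odd_poch N = inv_neg_poch 0 N.
Proof.
have := neg_pochK 0 N; rewrite addn0 -euler_sum_neg_poch // [neg_poch 0]big_ord0 => h.
by rewrite -[LHS]mulr1 -h mulrA odd_poch_euler_sumN mul1r.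
Qed.

Lemma p1_series_p2_series : (1 - q) * p1_series + q * p2_series = q * alt_lambert.
Proof.
rewrite -neg_lambert_odd_lambert -p2_series_neg_lambert -odd_poch_inv_neg_poch.
transitivity ((1 - q) * p1_series + q * odd_lambert + q * (p2_series - odd_lambert));
    first by ring.
by rewrite p1_series_odd_lambert; ring.
Qed.

End NilpotentQSeries.

(** * Generating functions of weighted partitions *)

Lemma sum_multiplicities N (g : nat -> nat) (s : seq nat) :
  all (fun k => 0 < k <= N)%N s ->
  (\sum_(x <- s) g x = \sum_(k < N) g k.+1 * count_mem k.+1 s)%N.
Proof.
elim: s => [_|a s IH /= /andP[/andP[a0 aN] /IH Hs]].
  by rewrite big_nil big1 // => k _; rewrite muln0.
rewrite big_cons Hs; under [RHS]eq_bigr => k _ do rewrite mulnDr.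
rewrite big_split /=; congr (_ + _)%N.
have ltaN : (a.-1 < N)%N by rewrite prednK.
rewrite (bigD1 (Ordinal ltaN)) //= prednK // eqxx muln1 big1 ?addn0 // => k nk.
case: eqP => [ak|_]; last by rewrite muln0.
by case/eqP: nk; apply: val_inj; rewrite /= ak.
Qed.

Lemma partition_bounds N n s : is_partition n s -> (n <= N)%N ->
  all (fun k => 0 < k <= N)%N s.
Proof.
case/and3P=> _ s0 /eqP sn nN; apply/allP => k ks; apply/andP; split.
  by rewrite lt0n; apply: contraNneq s0 => <-.
by rewrite (leq_trans (leq_mem_sumn ks)) // sn.
Qed.

(** Index k stands for the part k + 1. Multiplicities in a partition of n <= N are at most N, so
    [inord] does not alter them. *)
Definition mult_ffun N (s : seq nat) : {ffun 'I_N.+1 -> 'I_N.+1} :=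
  [ffun k : 'I_N.+1 => inord (count_mem k.+1 s)].

Definition ffun_weight N (f : {ffun 'I_N.+1 -> 'I_N.+1}) : nat :=
  (\sum_(k < N.+1) k.+1 * f k)%N.

Lemma mult_ffunE N n s k : is_partition n s -> (n <= N)%N ->
  mult_ffun N s k = count_mem k.+1 s :> nat.
Proof.
case/and3P=> _ s0 /eqP sn nN; rewrite ffunE inordK // ltnS.
by rewrite (leq_trans (count_size _ _)) // (leq_trans (size_leq_sumn s0)) // sn.
Qed.

Lemma mult_ffun_inj N n : (n <= N)%N ->
  {in partitions n &, injective (mult_ffun N)}.
Proof.
move=> nN s t; rewrite !mem_partitions => ps pt est.
have /allP bs := partition_bounds ps nN; have /allP bt := partition_bounds pt nN.
case/and3P: (ps) => ss _ _; case/and3P: (pt) => st _ _.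
apply: (sorted_eq (leT := geq)) => //.
- by move=> a b c /= ab bc; apply: leq_trans bc ab.
- by move=> a b /= /andP[ab ba]; apply/eqP; rewrite eqn_leq ab ba.
apply/allP => x xst; apply/eqP.
have /andP[x0 xN] : (0 < x <= N)%N.
  by move: xst; rewrite mem_cat => /orP[/bs|/bt].
have ltx : (x.-1 < N.+1)%N by lia.
have := mult_ffunE (Ordinal ltx) ps nN; rewrite est (mult_ffunE _ pt nN) /= prednK //.
Qed.

Lemma mult_ffun_surj N n (f : {ffun 'I_N.+1 -> 'I_N.+1}) : (n <= N)%N ->
  ffun_weight f = n -> exists2 s, s \in partitions n & f = mult_ffun N s.
Proof.
move=> nN fn.
(* Each part k + 1 is repeated [f k] times; sorting this sequence gives the preimage. *)
pose u := flatten [seq nseq (f k) k.+1 | k <- enum 'I_N.+1].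
have cu (k : 'I_N.+1) : count_mem k.+1 u = f k.
  rewrite /u count_flatten -map_comp sumnE big_map big_enum /= (bigD1 k) //=.
  rewrite count_nseq /= eqxx mul1n big1 ?addn0 // => j jk.
  by rewrite count_nseq /= eqSS (negbTE (jk : val j != val k)).
have bu : all (fun k => 0 < k <= N.+1)%N u.
  apply/allP => x /flatten_mapP[k _]; rewrite mem_nseq => /andP[_ /eqP ->].
  by rewrite /= ltn_ord.
have ps : is_partition n (sort geq u).
  apply/and3P; split.
  - by apply: sort_sorted => a b /=; apply: leq_total.
  - by rewrite mem_sort; apply/negP => /(allP bu).
  - rewrite (perm_sumn (_ : perm_eq _ u)) ?perm_sort // sumnE.
    rewrite (sum_multiplicities id bu) -fn /ffun_weight; apply/eqP.
    by apply: eq_bigr => k _; rewrite cu.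
exists (sort geq u); first by rewrite mem_partitions.
apply/ffunP => k; apply: val_inj.
rewrite /= (mult_ffunE _ ps nN) -cu; apply/esym.
by apply/permP; rewrite perm_sort.
Qed.

Section GeneratingFunctions.

Variables (R : comNzRingType) (M : nat) (q : R).
(** The order is at least 2, so that the sums over multiplicities c < N contain both c = 0 and c =
    1. *)
Local Notation N := M.+2.
Hypothesis qN0 : q ^+ N = 0.

(** Expanding the product chooses a multiplicity for every part, which determines a partition;
    choices of weight at least N vanish because q^N = 0. *)
Lemma partition_gf (phi : nat -> nat -> R) :
  \sum_(n < N) (\sum_(s <- partitions n) \prod_(k < N) phi k.+1 (count_mem k.+1 s))
    * q ^+ n
  = \prod_(k < N) \sum_(c < N) phi k.+1 c * q ^+ (k.+1 * c).
Proof.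
rewrite bigA_distr_bigA /=.
transitivity (\sum_(f : {ffun 'I_N -> 'I_N}) \sum_(n < N | ffun_weight f == n)
    (\prod_(k < N) phi k.+1 (f k)) * q ^+ n); last first.
  apply: eq_bigr => f _; rewrite big_split /= prodrXr -/(ffun_weight f).
  have [ltfN|leNf] := ltnP (ffun_weight f) N.
    by rewrite (big_pred1 (Ordinal ltfN)) // => n; rewrite /= eq_sym.
  rewrite (nilp_expr0 qN0 leNf) mulr0 big_pred0 // => n.
  by apply/eqP => fn; move: leNf; rewrite fn leqNgt ltn_ord.
rewrite (exchange_big_dep xpredT) //=; apply: eq_bigr => n _.
rewrite -mulr_suml; congr (_ * _).
have nN : (n <= M.+1)%N by rewrite -ltnS.
transitivity (\sum_(f <- [seq mult_ffun M.+1 s | s <- partitions n])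
   \prod_(k < N) phi k.+1 (f k)).
  rewrite big_map big_seq [RHS]big_seq; apply: eq_bigr => s.
  rewrite mem_partitions => ps; apply: eq_bigr => k _.
  by rewrite (mult_ffunE _ ps nN).
rewrite -[RHS]big_filter; apply: perm_big; apply: uniq_perm.
- by rewrite map_inj_in_uniq ?partitions_uniq //; apply: mult_ffun_inj.
- by rewrite filter_uniq // index_enum_uniq.
move=> f; rewrite mem_filter mem_index_enum andbT; apply/mapP/eqP.
  case=> s; rewrite mem_partitions => ps ->.
  rewrite /ffun_weight; under eq_bigr => k _ do rewrite (mult_ffunE _ ps nN).
  rewrite -(sum_multiplicities id) -?sumnE; first by case/and3P: ps => _ _ /eqP.
  by apply: partition_bounds ps _; apply: leqW.
by move=> fn; have [s ? ?] := mult_ffun_surj nN fn; exists s.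
Qed.

(** * Partitions with a prescribed largest part *)

Lemma largest_ub s x : x \in s -> (x <= largest s)%N.
Proof. by move=> xs; apply: (@leq_bigmax_seq _ _ xpredT id). Qed.

Lemma largest_mem s : s != [::] -> largest s \in s.
Proof.
case: s => // a s _; rewrite /largest; elim: s a => [|b s IH] a.
  by rewrite big_seq1 inE.
rewrite big_cons; have := IH b; move: (\max_(k <- b :: s) k) => y hy.
by rewrite /maxn; case: ifP => _; [rewrite inE hy orbT | rewrite inE eqxx].
Qed.

(* Local weights forcing t to be the largest part. *)
Definition capped t (g : nat -> nat -> R) k c : R :=
  if (k < t)%N then g k c else if k == t then (0 < c)%:R else (c == 0)%:R.

Lemma capped_prod t (g : nat -> nat -> R) n s : is_partition n s -> (n < N)%N ->
  (0 < t <= N)%N ->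
  \prod_(k < N) capped t g k.+1 (count_mem k.+1 s) =
  if largest s == t then \prod_(k < N | (k.+1 < t)%N) g k.+1 (count_mem k.+1 s)
  else 0.
Proof.
move=> ps nN /andP[t0 tN].
have /allP bs := partition_bounds ps (ltnW nN).
have zero k : (k < N)%N -> capped t g k.+1 (count_mem k.+1 s) = 0 ->
    \prod_(k < N) capped t g k.+1 (count_mem k.+1 s) = 0.
  by move=> kN h; rewrite (bigD1 (Ordinal kN)) //= h mul0r.
case: eqP => [Lt|/eqP Lt].
  rewrite (bigID (fun k : 'I_N => (k.+1 < t)%N)) /= [X in _ * X]big1 ?mulr1.
    by apply: eq_bigr => k kt; rewrite /capped kt.
  move=> k kt; rewrite /capped (negbTE kt); case: eqP => [->|/eqP kt'].
    rewrite -has_count has_pred1 -Lt largest_mem //.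
    by apply: contraTneq t0 => s0; rewrite -Lt s0 /largest big_nil.
  suff /count_memPn-> : k.+1 \notin s by [].
  by apply/negP => /largest_ub; rewrite Lt; lia.
have [lt|lt] := ltnP (largest s) t.
  apply: (zero t.-1); first by lia.
  rewrite prednK // /capped ltnn eqxx.
  suff /count_memPn-> : t \notin s by [].
  by apply/negP => /largest_ub; rewrite leqNgt lt.
have Ls : largest s \in s.
  by apply: largest_mem; apply: contraTneq t0 => s0; move: lt;
      rewrite s0 /largest big_nil; lia.
have L0 : (0 < largest s)%N by lia.
apply: (zero (largest s).-1); first by have := bs _ Ls; lia.
rewrite prednK // /capped ltnNge lt (negbTE Lt) /=.
by rewrite -leqn0 leqNgt -has_count has_pred1 Ls.
Qed.

(** The part t occurs at least once, which gives q^t / (1 - q^t); parts above t contribute 1 and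
    parts below t keep their weights g. *)
Lemma capped_gf t (g : nat -> nat -> R) : (0 < t <= N)%N ->
  \sum_(n < N) (\sum_(s <- partitions n | largest s == t)
     \prod_(k < N | (k.+1 < t)%N) g k.+1 (count_mem k.+1 s)) * q ^+ n =
  q ^+ t * inv_subX N q t * \prod_(k < t.-1) \sum_(c < N) g k.+1 c * q ^+ (k.+1 * c).
Proof.
move=> /[dup] tb /andP[t0 tN].
transitivity (\sum_(n < N) (\sum_(s <- partitions n)
    \prod_(k < N) capped t g k.+1 (count_mem k.+1 s)) * q ^+ n).
  apply: eq_bigr => n _; congr (_ * _).
  rewrite [RHS](eq_big_seq (fun s => if largest s == t then
    \prod_(k < N | (k.+1 < t)%N) g k.+1 (count_mem k.+1 s) else 0)).
    by rewrite -big_mkcond.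
  by move=> s; rewrite mem_partitions => ps; rewrite (capped_prod _ ps).
rewrite partition_gf.
have tN' : (t.-1 < N)%N by lia.
rewrite (bigD1 (Ordinal tN')) //= prednK //; congr (_ * _).
  rewrite /capped ltnn eqxx big_ord_recl /= mul0r add0r.
  (* The cut geometric series has one extra term, q^(t N) = 0. *)
  rewrite /inv_subX /geom [in RHS]big_ord_recr /= -exprM mulrDr -exprD.
  rewrite [q ^+ (t + _)](nilp_expr0 qN0) //; last by have := leq_pmull M.+1 t0; lia.
  rewrite addr0 mulr_sumr; apply: eq_bigr => c _.
  by rewrite mul1r -exprM -exprD mulnS.
rewrite (bigID (fun k : 'I_N => (k < t.-1)%N)) /= [X in _ * X]big1 ?mulr1; last first.
  move=> k /andP[kt kt']; rewrite big_ord_recl /= muln0 mulr1 /capped.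
  have -> : (k.+1 < t)%N = false by apply/negbTE; lia.
  have -> : (k.+1 == t) = false.
    by apply: contra_neqF kt => /eqP kt''; apply: val_inj; rewrite /= -kt''.
  by rewrite eqxx big1 ?addr0 // => c _; rewrite mul0r.
rewrite (big_ord_widen_cond N xpredT
   (fun k => \sum_(c < N) g k.+1 c * q ^+ (k.+1 * c))) /=; last by lia.
apply: eq_big => [k|k].
  by rewrite andbC; case: ltnP => //= kt; rewrite neq_ltn /= kt.
by move=> /andP[_ kt]; apply: eq_bigr => c _; rewrite /capped ifT //; lia.
Qed.

(** The condition n > 0 excludes the empty partition, whose largest part 0 is even but not of the
    form 2(m+1). *)
Lemma sum_largest_even (F : seq nat -> R) (P : pred (seq nat)) n :
  (0 < n < N)%N -> (forall s, P s -> ~~ odd (largest s)) ->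
  \sum_(s <- partitions n | P s) F s =
  \sum_(m < N | (2 * m.+1 <= N)%N)
    \sum_(s <- partitions n | largest s == (2 * m.+1)%N) (if P s then F s else 0).
Proof.
move=> /andP[n0 nN] Pe; rewrite (exchange_big_dep xpredT) //= big_mkcond /=.
apply: eq_big_seq => s; rewrite mem_partitions => ps.
have sn : s != [::] by apply: contraTneq n0 => s0; case/and3P: ps => _ _;
    rewrite s0 => /eqP <-.
have Ls := largest_mem sn; have /allP/(_ _ Ls) := partition_bounds ps (ltnW nN).
move=> /andP[L0 LN]; case: ifPn => Ps; last by rewrite big1.
have := Pe _ Ps; move: L0 LN; set L := largest s => L0 LN Le.
have LE : L = (2 * (L./2.-1).+1)%N by have := odd_double_half L; rewrite (negbTE Le); lia.
have ltm : (L./2.-1 < N)%N by lia.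
rewrite (big_pred1 (Ordinal ltm)) // => m; rewrite /= [in LHS]LE -val_eqE /=.
by apply/andP/eqP => [[_ /eqP]|->]; [lia | split; [rewrite -LE|]].
Qed.

Definition p1_factor t k c : R :=
  if odd k && (k != t - 1)%N then (if (c <= 1)%N then (-1) ^+ c else 0)
  else (c == 0)%:R.

Lemma p1_weight n s : is_partition n s -> (n < N)%N -> ~~ odd (largest s) ->
  \prod_(k < N | (k.+1 < largest s)%N) p1_factor (largest s) k.+1 (count_mem k.+1 s) =
  if p1_admissible s then (-1) ^+ count odd s else 0.
Proof.
move=> ps nN Le; have bs := partition_bounds ps (ltnW nN).
set L := largest s in Le *.
have zero k : k \in s -> (k < L)%N -> p1_factor L k (count_mem k s) = 0 ->
    \prod_(k < N | (k.+1 < L)%N) p1_factor L k.+1 (count_mem k.+1 s) = 0.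
  move=> ks kL h; have /andP[k0 kN] := allP bs _ ks.
  have ltk : (k.-1 < N)%N by lia.
  by rewrite (bigD1 (Ordinal ltk)) /= prednK // h mul0r.
rewrite /p1_admissible -/L Le /=; set sm := [seq k <- s | (k < L)%N].
have csm k : (k < L)%N -> count_mem k sm = count_mem k s.
  move=> kL; rewrite count_filter; apply: eq_count => x /=.
  by case: eqP => // ->; rewrite kL.
case: (boolP (all _ sm)) => [/allP allok|]; last first.
  case/allPn => k; rewrite mem_filter => /andP[kL ks] bad; rewrite andbF.
  apply: (zero k) => //; rewrite /p1_factor (negbTE bad).
  by rewrite -leqn0 leqNgt -has_count has_pred1 ks.
case: (boolP (uniq sm)) => [usm|nu] /=; last first.
  have [k ksm ck] : exists2 k, k \in sm & (1 < count_mem k sm)%N.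
    apply/hasP; apply: contraNT nu => /hasPn h; apply: count_mem_uniq => x.
    case: (boolP (x \in sm)) => [xs|/count_memPn //].
    have := h _ xs; rewrite -leqNgt; have : (0 < count_mem x sm)%N.
      by rewrite -has_count has_pred1.
    by case: (count_mem x sm) => [|[]].
  have ok := allok _ ksm.
  move: ksm; rewrite mem_filter => /andP[kL ks]; apply: (zero k) => //.
  by rewrite /p1_factor ok leqNgt -csm // ck.
transitivity (\prod_(k < N | (k.+1 < L)%N) (-1 : R) ^+ (odd k.+1 * count_mem k.+1 s)).
  apply: eq_bigr => k kL; rewrite /p1_factor -csm // (count_uniq_mem _ usm).
  case: (boolP (k.+1 \in sm)) => [/allok ok|_]; last first.
    by rewrite muln0; case: ifP.
  by rewrite ok; case/andP: ok => ->.
rewrite prodrXr; congr (_ ^+ _).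
transitivity (\sum_(k < N) odd k.+1 * count_mem k.+1 s)%N; last first.
  by rewrite -(sum_multiplicities (fun k => odd k : nat) bs) -sumn_count sumnE big_map.
(* The only part not below L is L itself, which is even and adds nothing to the number of odd
   parts. *)
rewrite [RHS](bigID (fun k : 'I_N => (k.+1 < L)%N)) /= [X in (_ + X)%N]big1 ?addn0 //.
move=> k kL; have [eL|kL'] := eqVneq k.+1 L;
    first by rewrite -[~~ odd k]/(odd k.+1) eL (negbTE Le).
suff /count_memPn-> : k.+1 \notin s by rewrite muln0.
by apply/negP => /largest_ub; rewrite -/L; lia.
Qed.

(** The common pattern of [p1_gf] and [p2_gf]: once the largest part 2(m+1) is fixed, the weight is
    a product of local factors and [capped_gf] applies; terms with 2(m+1) > N vanish. *)
Lemma gf_by_largest (p : nat -> int) (P : pred (seq nat)) (F : seq nat -> int)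
    (g : nat -> nat -> nat -> R) :
  (forall n, p n = \sum_(s <- partitions n | P s) F s) ->
  (forall s, P s -> ~~ odd (largest s)) ->
  (forall m n s, is_partition n s -> (n < N)%N -> largest s = (2 * m.+1)%N ->
    \prod_(k < N | (k.+1 < 2 * m.+1)%N) g m k.+1 (count_mem k.+1 s) =
    if P s then (F s)%:~R else 0) ->
  \sum_(n < N | (0 < n)%N) (p n)%:~R * q ^+ n =
  \sum_(m < N) q ^+ (2 * m.+1) * inv_subX N q (2 * m.+1) *
    \prod_(k < (2 * m).+1) \sum_(c < N) g m k.+1 c * q ^+ (k.+1 * c).
Proof.
move=> pE Pe gE; rewrite [RHS](bigID (fun m : 'I_N => (2 * m.+1 <= N)%N)) /=.
rewrite [X in _ = _ + X]big1 ?addr0; last first.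
  by move=> m; rewrite -ltnNge => /ltnW mN; rewrite (nilp_expr0 qN0 mN) !mul0r.
transitivity (\sum_(n < N) \sum_(m < N | (2 * m.+1 <= N)%N)
   (\sum_(s <- partitions n | largest s == (2 * m.+1)%N)
     \prod_(k < N | (k.+1 < 2 * m.+1)%N) g m k.+1 (count_mem k.+1 s)) * q ^+ n).
  rewrite big_mkcond /=; apply: eq_bigr => n _; case: ifPn => n0; last first.
    rewrite big1 // => m _; rewrite big1_seq ?mul0r // => s /andP[/eqP Ls].
    rewrite mem_partitions => ps; move: Ls.
    have : n = 0%N :> nat by lia.
    case/and3P: ps => _ s0 /eqP <- h; have := size_leq_sumn s0; rewrite h.
    by case: (s) => // _; rewrite /largest big_nil.
  rewrite -mulr_suml; congr (_ * _); rewrite pE rmorph_sum /=.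
  rewrite (@sum_largest_even _ P n) //; last by rewrite n0 ltn_ord.
  apply: eq_bigr => m _; rewrite big_seq_cond [RHS]big_seq_cond.
  apply: eq_bigr => s /andP[]; rewrite mem_partitions => ps /eqP Ls.
  by rewrite (gE _ _ _ ps).
rewrite exchange_big /=; apply: eq_bigr => m mN.
rewrite capped_gf; last by rewrite mN muln_gt0.
by rewrite (_ : (2 * m.+1).-1 = (2 * m).+1) //; lia.
Qed.

Lemma p1_gf : \sum_(n < N | (0 < n)%N) (p1 n)%:~R * q ^+ n = p1_series N q.
Proof.
rewrite (@gf_by_largest p1 p1_admissible (fun s => (-1) ^+ count odd s)
  (fun m => p1_factor (2 * m.+1))) //; first last.
- move=> m n s ps nN Ls; rewrite -Ls (p1_weight ps) ?Ls ?mul2n ?odd_double //.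
  by case: ifP => // _; rewrite rmorphXn rmorphN rmorph1.
- by move=> s /and3P[].
apply: eq_bigr => m _; congr (_ * _).
transitivity (\prod_(k < (2 * m).+1) (if odd k.+1 && (k.+1 != (2 * m).+1) then 1 -
    q ^+ k.+1 else 1)).
  apply: eq_bigr => k _; rewrite /p1_factor (_ : (2 * m.+1 - 1)%N = (2 * m).+1);
      last by lia.
  rewrite big_ord_recl big_ord_recl big1 /= ?addr0; last first.
    by move=> i _; case: ifP => _; rewrite mul0r.
  by case: ifP => _; rewrite muln0 muln1 ?mul0r ?addr0 ?mulr1 ?expr1 ?mulN1r.
(* The last factor belongs to the part 2m + 1, just below the largest part 2m + 2 and hence
   forbidden. *)
rewrite big_ord_recr /= eqxx andbF mulr1 /odd_poch.
transitivity (\prod_(k < 2 * m) (if odd k.+1 then 1 - q ^+ k.+1 else 1)).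
  by apply: eq_bigr => k _; rewrite (_ : (k.+1 != _) = true) ?andbT //;
      have := ltn_ord k; lia.
elim: (m : nat) => [|j IH]; first by rewrite muln0 !big_ord0.
by rewrite mulnS !addSn add0n !big_ord_recr /= IH mul2n odd_double /= mulr1.
Qed.

(** The largest part is 2(m+1), so its half is m + 1 and the forbidden range starts right after
    m. *)
Definition p2_factor m k c : R := if (k <= m)%N then (-1) ^+ c else (c == 0)%:R.

Lemma p2_weight m n s : is_partition n s -> (n < N)%N -> largest s = (2 * m.+1)%N ->
  \prod_(k < N | (k.+1 < 2 * m.+1)%N) p2_factor m k.+1 (count_mem k.+1 s) =
  if p2_admissible s then (-1) ^+ (size s - largest_mult s)%N else 0.
Proof.
move=> ps nN Ls; have bs := partition_bounds ps (ltnW nN).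
rewrite /p2_admissible /largest_mult Ls mul2n odd_double doubleK /= -mul2n.
case: (boolP (all _ s)) => [/allP ok|]; last first.
  case/allPn => k ks; rewrite negbK => /andP[mk kL]; have /andP[k0 kN] := allP bs _ ks.
  have ltk : (k.-1 < N)%N by lia.
  rewrite (bigD1 (Ordinal ltk)) /= prednK //; last by lia.
  rewrite /p2_factor leqNgt mk /= -leqn0 leqNgt -has_count has_pred1 ks; exact: mul0r.
transitivity (\prod_(k < N | (k.+1 < 2 * m.+1)%N) (-1 : R) ^+ count_mem k.+1 s).
  apply: eq_bigr => k kL; rewrite /p2_factor; case: leqP => // mk.
  suff /count_memPn-> : k.+1 \notin s by [].
  by apply/negP => /ok; lia.
rewrite prodrXr; congr (_ ^+ _).
have -> : size s = (\sum_(k < N) 1 * count_mem k.+1 s)%N.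
  by rewrite -(sum_multiplicities (fun=> 1%N) bs) sum1_size.
rewrite [in RHS](bigID (fun k : 'I_N => (k.+1 < 2 * m.+1)%N)) /=.
(* Index 2m + 1 is the position of the largest part 2(m+1), whose multiplicity is subtracted from
   the size. *)
have topN : ((2 * m).+1 < N)%N.
  have : (2 * m.+1)%N \in s.
    by rewrite -Ls; apply: largest_mem; apply/eqP => s0; move: Ls;
        rewrite s0 /largest big_nil.
  by move=> /(allP bs) /andP[_]; lia.
rewrite [X in (_ + X)%N](bigD1 (Ordinal topN)) /=; last by lia.
rewrite (_ : (2 * m).+2 = 2 * m.+1)%N; last by lia.
rewrite [X in (_ + (_ + X))%N]big1 ?addn0.
  by rewrite mul1n addnK; apply: eq_bigr => k _; rewrite mul1n.
move=> k /andP[kL kn]; rewrite mul1n.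
suff /count_memPn-> : k.+1 \notin s by [].
apply/negP => /largest_ub; rewrite Ls => le.
by move: kn; rewrite -val_eqE /=; lia.
Qed.

Lemma p2_gf : \sum_(n < N | (0 < n)%N) (p2 n)%:~R * q ^+ n = p2_series N q.
Proof.
rewrite (@gf_by_largest p2 p2_admissible (fun s => (-1) ^+ (size s - largest_mult s))
  (fun m => p2_factor m)) //; first last.
- by move=> m n s ps nN Ls; rewrite (p2_weight ps nN Ls); case: ifP => // _;
    rewrite rmorphXn rmorphN rmorph1.
- by move=> s /andP[].
apply: eq_bigr => m _; congr (_ * _).
(* The 2m + 1 smaller sizes are m free ones, each contributing 1 / (1 + q^k), and m + 1 forbidden
   ones, each contributing 1. *)
rewrite (_ : (2 * m).+1 = (m + m.+1)%N); last by lia.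
rewrite big_split_ord /= [X in _ * X]big1 ?mulr1; last first.
  move=> k _; rewrite /p2_factor leqNgt ltnS leq_addr /= big_ord_recl /= muln0 mulr1
      big1 ?addr0 //.
  by move=> c _; rewrite mul0r.
apply: eq_bigr => k _; rewrite addn0 /inv_addX /geom; apply: eq_bigr => c _.
by rewrite /p2_factor ltn_ord [in RHS]exprNn exprM.
Qed.

End GeneratingFunctions.

(** * Divisor sums and extraction of coefficients *)

Lemma sum_divisors (V : nmodType) N n (F : nat -> V) : (0 < n <= N)%N ->
  \sum_(d <- divisors n) F d = \sum_(i < N | (i.+1 %| n)%N) F i.+1.
Proof.
move=> /andP[n0 nN].
rewrite -(big_mkord (fun i => (i.+1 %| n)%N) (fun i => F i.+1)) -big_filter.
rewrite -(big_map S xpredT F); apply: perm_big; apply: uniq_perm.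
- exact: divisors_uniq.
- by rewrite map_inj_uniq ?filter_uniq ?iota_uniq // => a b [].
move=> d; rewrite -dvdn_divisors //; apply/idP/mapP.
  move=> dn; have d0 := dvdn_gt0 n0 dn; exists d.-1; last by rewrite prednK.
  rewrite mem_filter prednK // dn mem_index_iota /=.
  by have := dvdn_leq n0 dn; lia.
by case=> i; rewrite mem_filter => /andP[? _] ->.
Qed.

Lemma tau_diff n : (tau_o n)%:Z - (tau_e n)%:Z = \sum_(d <- divisors n) (-1) ^+ d.+1.
Proof.
rewrite /tau_o /tau_e -!sumn_count !sumnE !big_map -!natz !natr_sum -sumrB.
by apply: eq_bigr => d _; rewrite -signr_odd /=; case: (odd d).
Qed.

Section Divisors.

Variables (R : comNzRingType) (N : nat) (q : R).
Hypothesis qN0 : q ^+ N = 0.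

(** Expanding q^k / (1 + q^k) as the sum of (-1)^i q^(k(i+1)), the coefficient of q^n collects
    (-1)^(d+1) over the divisors d = i + 1 of n. *)
Lemma tau_gf : \sum_(n < N | (0 < n)%N) ((tau_o n)%:Z - (tau_e n)%:Z)%:~R * q ^+ n =
  alt_lambert N q.
Proof.
transitivity (\sum_(n < N | (0 < n)%N) \sum_(i < N) \sum_(k < N | (k.+1 * i.+1 == n)%N)
    (-1) ^+ i * q ^+ (k.+1 * i.+1)).
  apply: eq_bigr => n n0; rewrite tau_diff (@sum_divisors _ N); last first.
    by rewrite n0 ltnW.
  rewrite rmorph_sum mulr_suml big_mkcond /=; apply: eq_bigr => i _.
  case: ifPn => [/dvdnP[k nk]|ndvd].
    have k0 : (0 < k)%N by move: n0; rewrite nk; case: (k).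
    have kN : (k.-1 < N)%N by have := ltn_ord n; rewrite nk; nia.
    rewrite (big_pred1 (Ordinal kN)) => [|j] /=.
      by rewrite prednK // -nk rmorphXn rmorphN rmorph1 !exprS !mulN1r opprK.
    rewrite nk eqn_pmul2r // -val_eqE /=; lia.
  rewrite big_pred0 // => k; apply/negbTE; apply: contraNN ndvd => /eqP <-.
  exact: dvdn_mull.
rewrite exchange_big /=; transitivity
  (\sum_(i < N) \sum_(k < N) (-1) ^+ i * q ^+ (k.+1 * i.+1)).
  apply: eq_bigr => i _; rewrite (exchange_big_dep xpredT) //=.
  apply: eq_bigr => k _; have [ltN|leN] := ltnP (k.+1 * i.+1) N.
    rewrite (big_pred1 (Ordinal ltN)) // => n; rewrite /= -val_eqE /=.
    by rewrite eq_sym; case: eqP => [->|]; rewrite ?andbF // andbT.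
  rewrite (nilp_expr0 qN0 leN) mulr0 big1 //.
rewrite exchange_big /=; apply: eq_bigr => k _; rewrite /inv_addX /geom mulr_sumr.
by apply: eq_bigr => i _; rewrite [in RHS]exprNn -exprM mulnS exprD; ring.
Qed.

End Divisors.

Lemma in_qpolyXn_eq0_coef (R : comNzRingType) n (P : {poly R}) i :
  in_qpoly 'X^(n.+1) P = 0 -> (i <= n)%N -> P`_i = 0.
Proof.
move=> /(congr1 val) /=; rewrite mk_monic_Xn /= => h le_in.
have := Pdiv.RingMonic.rdivp_eq (monicXn R n.+1) P.
by rewrite h addr0 => ->; rewrite coefMXn ltnS le_in.
Qed.

Lemma coef_intr_sum N (a : nat -> int) i :
  (\sum_(n < N | (0 < n)%N) (a n)%:~R * 'X^n : {poly int})`_i =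
  if (0 < i < N)%N then a i else 0.
Proof.
rewrite coef_sum.
transitivity (\sum_(n < N | (0 < n)%N && (n == i :> nat)) a n).
  rewrite [RHS]big_mkcondr; apply: eq_bigr => n _.
  rewrite mulrzl coefMrz coefXn [i == _]eq_sym.
  by case: eqP => _; rewrite ?intz ?mul0rz.
case: ifPn => [/andP[i0 iN]|h].
  rewrite (big_pred1 (Ordinal iN)) // => n; rewrite /= -val_eqE /=.
  by case: eqP => [->|]; rewrite ?andbF // i0.
rewrite big_pred0 // => n; apply/negbTE; apply: contraNN h => /andP[n0 /eqP <-].
by rewrite n0 ltn_ord.
Qed.

Lemma p1_step n : (1 <= n)%N ->
  p1 n - p1 n.+1 = p2 n + (tau_e n)%:Z - (tau_o n)%:Z.
Proof.
move=> n1; pose S (a : nat -> int) : {poly int} :=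
  \sum_(k < n.+2 | (0 < k)%N) (a k)%:~R * 'X^k.
pose t k := (tau_o k)%:Z - (tau_e k)%:Z.
(* The difference of the two sides of [p1_series_p2_series] at q = X, lifted to a polynomial that
   vanishes modulo X^(n+2). *)
pose P := (1 - 'X) * S p1 + 'X * S p2 - 'X * S t.
have P0 : in_qpoly 'X^(n.+2) P = 0.
  set q := in_qpoly ('X^(n.+2) : {poly int}) 'X.
  have qN : q ^+ n.+2 = 0.
    rewrite -rmorphXn; apply: val_inj => /=.
    by rewrite mk_monic_Xn Pdiv.RingMonic.rmodpp // monicXn.
  have SE a : in_qpoly 'X^(n.+2) (S a) = \sum_(k < n.+2 | (0 < k)%N) (a k)%:~R * q ^+ k.
    rewrite rmorph_sum; apply: eq_bigr => k _.
    by rewrite rmorphM rmorphXn rmorph_int.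
  rewrite rmorphB rmorphD !rmorphM rmorphB rmorph1 /= -/q !SE.
  rewrite (p1_gf qN) (p2_gf qN) (tau_gf qN) (p1_series_p2_series qN).
  exact: subrr.
(* The coefficient of X^(n+1) in P is p1(n+1) - p1(n) + p2(n) - t(n); the index n occurs in the sums
   because n >= 1. *)
have := in_qpolyXn_eq0_coef P0 (leqnn n.+1).
rewrite /P mulrBl mul1r !(coefD,
    coefN) !coefXM /= !coef_intr_sum !ltnS leqnn leqnSn n1 /=.
rewrite /t => h; lia.
Qed.

Lemma p1_1 : p1 1 = 0.
Proof.
rewrite /p1 big1_seq // => s /andP[/and3P[Le _ _]]; rewrite mem_partitions.
case/and3P => _ s0 /eqP s1; case: s s0 s1 Le => [|[|[|a]] [|[|b] s]] //=.
by rewrite /largest big_seq1.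
Qed.

Theorem theorem1p3 :
  (forall n : nat, (1 <= n)%N ->
     p1 n - p1 n.+1 = p2 n + (tau_e n)%:Z - (tau_o n)%:Z)
  /\
  (forall N : nat, (1 <= N)%N ->
     p1 N = \sum_(1 <= n < N) ((tau_o n)%:Z - (tau_e n)%:Z - p2 n)).
Proof.
split=> [n|]; first exact: p1_step.
case=> // N _; elim: N => [|N IH]; first by rewrite big_geq // p1_1.
rewrite big_nat_recr //= -IH.
have := p1_step (ltn0Sn N); lia.
Qed.
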